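(* Let $c$ be a closed $C^1$ curve in $\mathbb{H}^1$ which is a graph over its projection $\bar c$ to the $xy$-plane. Suppose $c$ has no Legendrian points and is spanned by a $C^1$ ruled H-minimal graph $S$. Then there exists a (nondegenerate) interval $I$ of parameters such that $c(I)$ is contained in a plane.
   Context: The Heisenberg group $\mathbb{H}^1$ is $\mathbb{R}^3$ with coordinates $(x,y,t)$ and vector fields $X_1=\partial_x-\frac y2\partial_t$, $X_2=\partial_y+\frac x2\partial_t$, $T=\partial_t$. A point $c(\theta_0)$ is Legendrian if $c'(\theta_0)\in\mathrm{span}\{X_1,X_2\}$ at $c(\theta_0)$. For a $C^1$ graph $t=u(x,y)$ over $\Omega\subset\mathbb{R}^2$ put $p=X_1(t-u)$, $q=X_2(t-u)$; characteristic points are those with $p=q=0$ (the characteristic locus is the set of these), and elsewhere the unit horizontal Gauss map is $(\bar p,\bar q)=(p,q)/\sqrt{p^2+q^2}$. The graph is H-minimal if $\int_\Omega\bar p\,\phi_x+\bar q\,\phi_y\,dx\,dy=0$ for all $\phi\in C_0^\infty(\Omega)$. A $C^1$ ruled H-minimal graph over a closed domain $\Omega\subset\mathbb{R}^2$ is a $C^1$ H-minimal graph that is, away from the characteristic locus, a ruled surface whose rules are horizontal straight lines (lifts of the integral curves of $(\bar q,-\bar p)$), and such that every rule in $S$ that meets the characteristic locus may be extended over the characteristic locus as a straight line. $S$ spans $c$ if $S$ is a graph over a closed domain $\Omega$ with $\partial\Omega=\bar c$ and the boundary of $S$ is $c$.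
   Formalization: The closed curve c is taken to be simple and the closed domain Ω to be bounded; without these the claim fails, e.g. for t = √(x²+y²−1)/2 over the exterior of an off-centre circle, or over a crescent between two internally tangent off-centre circles, around the unit disc. *)

(* Defs.v *)
From HB Require Import structures.
From mathcomp Require Import all_boot all_order all_algebra.
From mathcomp Require Import all_classical all_reals all_analysis.
Set Implicit Arguments.
Unset Strict Implicit.
Unset Printing Implicit Defensive.
Import Order.TTheory GRing.Theory Num.Theory.
Import numFieldNormedType.Exports.
Local Open Scope classical_set_scope.
Local Open Scope ring_scope.

(* [((x, y), t)]: the first projection is the projection to the xy-plane. *)
Notation heisenberg R := ((R * R) * R)%type.

Section Heisenberg.
Variable R : realType.
Local Notation heis := (heisenberg R).

Definition X1 (P : heis) : heis := ((1, 0), - (P.1.2 / 2)).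
Definition X2 (P : heis) : heis := ((0, 1), P.1.1 / 2).

Definition horizontal_at (P v : heis) : Prop :=
  exists a b : R, v = a *: X1 P + b *: X2 P.

(* On an open subset [U] of a finite-dimensional space this is C^1 regularity
   on [U]. *)
Definition C1_on (V W : normedModType R) (U : set V) (f : V -> W) : Prop :=
  forall z, U z ->
    differentiable f z /\ forall v, {for z, continuous ('D_v f)}.

Definition boundary (T : topologicalType) (A : set T) : set T :=
  closure A `\` A°.

(* The circle of parameters is R modulo the period [L]. Closed curves are simple,
   as for the boundary of a surface; [c' = 0] is not excluded here, but such a
   point is Legendrian. *)
Definition closed_C1_curve (L : R) (c : R -> heis) : Prop :=
  [/\ 0 < L, C1_on setT c, (forall s, c (s + L) = c s) &
      forall s1 s2, 0 <= s1 < L -> 0 <= s2 < L -> c s1 = c s2 -> s1 = s2].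

Definition proj_curve (c : R -> heis) : R -> R * R := fun s => (c s).1.

Definition graph_over_projection (c : R -> heis) : Prop :=
  forall s1 s2, proj_curve c s1 = proj_curve c s2 -> c s1 = c s2.

Definition legendrian_point (c : R -> heis) (s : R) : Prop :=
  horizontal_at (c s) (derive1 c s).

Definition is_plane (A : set heis) : Prop :=
  exists a b d k : R, (a, b, d) <> (0, 0, 0) /\
    A = [set P : heis | a * P.1.1 + b * P.1.2 + d * P.2 = k].

Definition graph_pt (u : R * R -> R) (z : R * R) : heis := (z, u z).

Definition graph_over (W : set (R * R)) (u : R * R -> R) : set heis :=
  graph_pt u @` W.

(* The closure of a bounded domain. *)
Definition closed_domain (W : set (R * R)) : Prop :=
  compact W /\
  exists D : set (R * R), [/\ open D, connected D, D !=set0 & W = closure D].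

(* C^1 up to the boundary: [u] is C^1 on an open neighbourhood of [W]. *)
Definition C1_graph (W : set (R * R)) (u : R * R -> R) : Prop :=
  exists U : set (R * R), [/\ open U, W `<=` U & C1_on U u].

Section graph.
Variables (W : set (R * R)) (u : R * R -> R).

Let defect (P : heis) : R := P.2 - u P.1.

Definition gp (z : R * R) : R := 'D_(X1 (graph_pt u z)) defect (graph_pt u z).
Definition gq (z : R * R) : R := 'D_(X2 (graph_pt u z)) defect (graph_pt u z).

(* Since [0 / 0 = 0], the Gauss map takes the value 0 on the characteristic
   locus. *)
Definition gpbar (z : R * R) : R := gp z / Num.sqrt (gp z ^+ 2 + gq z ^+ 2).
Definition gqbar (z : R * R) : R := gq z / Num.sqrt (gp z ^+ 2 + gq z ^+ 2).

(* The characteristic locus and its complement, projected to the xy-plane. *)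
Definition char_locus : set (R * R) :=
  [set z | W z /\ (gp z = 0 /\ gq z = 0)].
Definition nonchar : set (R * R) := W `\` char_locus.

Definition smooth (f : R * R -> R) : Prop :=
  forall (vs : seq (R * R)) (z : R * R),
    differentiable (foldr (fun v (g : R * R -> R) => 'D_v g) f vs) z.

Definition test_function (f : R * R -> R) : Prop :=
  let supp := closure [set z | f z != 0] in
  [/\ smooth f, compact supp & supp `<=` W°].

Definition H_minimal : Prop :=
  forall f : R * R -> R, test_function f ->
    (\int[(@lebesgue_measure R \x @lebesgue_measure R)%E]_(z in W)
      (gpbar z * 'D_((1, 0) : R * R) f z
       + gqbar z * 'D_((0, 1) : R * R) f z)%:E = 0)%E.

Definition straight_line (r : R -> heis) : Prop :=
  exists P v : heis, forall s, r s = P + s *: v.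

(* The parameters reachable from 0 along the line [r] while its projection
   stays in [D]. *)
Definition stretch (D : set (R * R)) (r : R -> heis) : set R :=
  connected_component [set s | D (r s).1] 0.

(* [r] parametrizes a straight line; the rule itself is [r @` stretch nonchar r],
   a maximal segment of S off the characteristic locus. *)
Definition is_rule (r : R -> heis) : Prop :=
  [/\ straight_line r, (forall s, horizontal_at (r s) (derive1 r s)),
      nonchar (r 0).1 &
      forall s, stretch nonchar r s ->
        graph_over W u (r s) /\
        is_derive s 1 (fun k => (r k).1) (gqbar (r s).1, - gpbar (r s).1)].

Definition ruled_off_char : Prop :=
  forall z, nonchar z -> exists r, is_rule r /\ r 0 = graph_pt u z.

(* If the closure of a rule reaches the characteristic locus, the line carrying
   it remains in S for as long as its projection stays in [W]. *)
Definition rules_extend : Prop :=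
  forall r, is_rule r ->
    (exists2 s, closure (stretch nonchar r) s & char_locus (r s).1) ->
    forall s, stretch W r s -> graph_over W u (r s).

Definition C1_ruled_H_minimal_graph : Prop :=
  [/\ closed_domain W, C1_graph W u, H_minimal, ruled_off_char & rules_extend].

Definition spans (c : R -> heis) : Prop :=
  boundary W = range (proj_curve c) /\ graph_over (boundary W) u = range c.

End graph.

End Heisenberg.

(* Main.v *)
Require Import Defs.
From mathcomp Require Import all_boot all_order all_algebra.
From mathcomp Require Import all_classical all_reals all_analysis.
From mathcomp Require Import ring lra.
Set Implicit Arguments.
Unset Strict Implicit.
Unset Printing Implicit Defensive.
Import Order.TTheory GRing.Theory Num.Theory.
Import numFieldNormedType.Exports.
Local Open Scope classical_set_scope.
Local Open Scope ring_scope.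

(* Having no Legendrian points means that at every boundary point the direction
   of the rules is transverse to the projected curve; by connectedness it can be
   oriented so as to point into the domain everywhere along the boundary.
   Follow the rule from a boundary point [g s] until it leaves the domain, at
   [g (e s)]. At the exit the line is again tangent to a rule, and it arrives
   from inside, so the inward direction there is the opposite one. Hence
   [e] is a continuous injective lift of a circle map with
   [e (s + L) = e s + L], that is, [e] is increasing: it preserves
   the orientation of the boundary. Consequently two nearby chords have their
   initial points and their end points on opposite sides of each other, and
   cross. Since [H^1] contains no horizontal triangle, three pairwise crossing
   chords are concurrent, so all nearby chords pass through one point of S and
   lie in the horizontal plane of that point. *)

(** * Determinants in the plane and crossing segments *)

Definition det {R : realType} (a b : R * R) : R := a.1 * b.2 - a.2 * b.1.
Definition dot {R : realType} (a b : R * R) : R := a.1 * b.1 + a.2 * b.2.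

Section PlaneAlgebra.
Variable R : realType.
Implicit Types a b p v w z : R * R.

Lemma cvg_fst_comp {T} {F : set_system T} {FF : Filter F} (f : T -> R * R) a :
  f @ F --> a -> (f x).1 @[x --> F] --> a.1.
Proof. by move=> fa; apply: cvg_comp fa _; apply: cvg_fst. Qed.

Lemma cvg_snd_comp {T} {F : set_system T} {FF : Filter F} (f : T -> R * R) a :
  f @ F --> a -> (f x).2 @[x --> F] --> a.2.
Proof. by move=> fa; apply: cvg_comp fa _; apply: cvg_snd. Qed.

Lemma cvg_det {T} {F : set_system T} {FF : Filter F} (f g : T -> R * R) a b :
  f @ F --> a -> g @ F --> b -> det (f x) (g x) @[x --> F] --> det a b.
Proof.
by move=> fa gb; apply: cvgB; apply: cvgM;
  by [exact: cvg_fst_comp | exact: cvg_snd_comp].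
Qed.

Lemma cvg_dot {T} {F : set_system T} {FF : Filter F} (f g : T -> R * R) a b :
  f @ F --> a -> g @ F --> b -> dot (f x) (g x) @[x --> F] --> dot a b.
Proof.
by move=> fa gb; apply: cvgD; apply: cvgM;
  by [exact: cvg_fst_comp | exact: cvg_snd_comp].
Qed.

Lemma eq_pair {S T : Type} (a b : S * T) : a.1 = b.1 -> a.2 = b.2 -> a = b.
Proof. by case: a b => [? ?] [? ?] /= -> ->. Qed.

Lemma pairE :
  ((forall a b, (a + b).1 = a.1 + b.1) * (forall a b, (a + b).2 = a.2 + b.2)) *
  ((forall a, (- a).1 = - a.1) * (forall a, (- a).2 = - a.2)) *
  ((forall (k : R) a, (k *: a).1 = k * a.1) *
   (forall (k : R) a, (k *: a).2 = k * a.2)).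
Proof. by []. Qed.

Lemma detZl (k : R) a b : det (k *: a) b = k * det a b.
Proof. by rewrite /det !pairE; ring. Qed.

Lemma detZr (k : R) a b : det a (k *: b) = k * det a b.
Proof. by rewrite /det !pairE; ring. Qed.

Lemma dotZ (k : R) a b : dot (k *: a) (k *: b) = k * k * dot a b.
Proof. by rewrite /dot !pairE; ring. Qed.

Lemma parallel_unit a b : dot a a = 1 -> dot b b = 1 -> det a b = 0 ->
  a = b \/ a = - b.
Proof.
case: a b => [a1 a2] [b1 b2]; rewrite /det /dot /= => Ha Hb /subr0_eq Hab.
(* Together with [e2] this says that [a] is [k] times [b] for [k = dot a b]; comparing lengths gives
   [k ^+ 2 = 1]. *)
have e1 : a1 = b1 * (a1 * b1 + a2 * b2).
  by rewrite -[LHS]mulr1 -Hb; ring: Hab.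
have e2 : a2 = b2 * (a1 * b1 + a2 * b2).
  by rewrite -[LHS]mulr1 -Hb; ring: Hab.
set k := a1 * b1 + a2 * b2 in e1 e2.
have : k ^+ 2 = 1.
  have -> : k ^+ 2 = a1 * (b1 * k) + a2 * (b2 * k) by rewrite /k; ring.
  by rewrite -e1 -e2.
move/eqP; rewrite sqrf_eq1 => /orP[/eqP k1|/eqP k1]; [left|right];
  by rewrite e1 e2 k1 ?mulrN1 ?mulr1.
Qed.

Lemma det_eq0_dot v z : dot v v = 1 -> det v z = 0 -> z = dot v z *: v.
Proof.
move=> Hv /subr0_eq Hd; apply: eq_pair; rewrite pairE -[LHS]mulr1 -Hv /dot;
  by ring: Hd.
Qed.

(** Since [q1 - p1] is parallel to [w1] and [q2 - p2] to [w2], the hypotheses say that each line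
    separates the end points of the other segment. They are phrased by the displacements between
    initial points and between end points because monotonicity along the boundary controls exactly
    these. *)
Lemma crossing_segments p1 p2 w1 w2 (T1 T2 : R) :
  let q1 := p1 + T1 *: w1 in let q2 := p2 + T2 *: w2 in
  0 < T1 -> 0 < T2 ->
  det w1 (p2 - p1) * det w1 (q2 - q1) < 0 ->
  det w2 (p2 - p1) * det w2 (q2 - q1) < 0 ->
  det w1 w2 != 0 /\ exists t1 t2, [/\ 0 <= t1 <= T1, 0 <= t2 <= T2 &
    p1 + t1 *: w1 = p2 + t2 *: w2].
Proof.
move=> q1 q2 T1p T2p.
set A := det w1 (p2 - p1); set C := det w2 (p2 - p1); set K := det w1 w2.
have -> : det w1 (q2 - q1) = A + T2 * K.
  by rewrite /A /K /q1 /q2 /det !pairE; ring.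
have -> : det w2 (q2 - q1) = C + T1 * K.
  by rewrite /C /K /q1 /q2 /det !pairE; ring.
move=> hA hC.
have K0 : K != 0.
  apply/eqP => K0; move: hA; rewrite K0 mulr0 addr0 -expr2 => /lt_geF.
  by rewrite sqr_ge0.
(* The parameters come from Cramer's rule: take determinants of the intersection equation with [w2]
   and with [w1]. *)
split=> //; exists (- C / K), (- A / K).
(* An affine function of slope [K] with values of opposite sign at 0 and [T] has its zero [- X / K]
   in between. *)
have bnd (X T : R) : 0 < T -> X * (X + T * K) < 0 -> 0 <= - X / K <= T.
  move=> Tp; have -> : X = - (- X / K) * K by field.
  set t := - X / K => h.
  have {}h : K ^+ 2 * (t * (t - T)) < 0.
    by rewrite (_ : K ^+ 2 * _ = - t * K * (- t * K + T * K)) //; ring.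
  move: h; rewrite pmulr_rlt0 ?exprn_even_gt0 // => h.
  by rewrite (_ : - (- t * K) / K = t); [apply/andP; split; nra|field].
split; [exact: bnd|exact: bnd|].
apply: eq_pair; rewrite !pairE;
  move: K0; rewrite /A /C /K /det !pairE => K0; field => //.
Qed.

(* Along a horizontal line from [x] to [y] the height changes by [det x y / 2],
   so a closed horizontal triangle bounds area 0. *)
Lemma horizontal_triangle (u : R * R -> R) x y z (al be : R) w1 w2 :
  det w1 w2 != 0 ->
  y = x + al *: w1 -> z = x + be *: w2 ->
  u y - u x = det x y / 2 -> u z - u x = det x z / 2 ->
  u z - u y = det y z / 2 -> x = y \/ x = z.
Proof.
move=> K ey ez h1 h2 h3.
have : al * be * det w1 w2 = 0.
  have : det x y + det y z - det x z = 0 by lra.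
  by rewrite ey ez /det !pairE => <-; ring.
move/eqP; rewrite mulf_eq0 (negPf K) orbF mulf_eq0 => /orP[]/eqP e.
  by left; rewrite ey e scale0r addr0.
by right; rewrite ez e scale0r addr0.
Qed.

End PlaneAlgebra.

(** * General facts on periodicity, convexity and connectedness *)

Lemma continuous_pair {R : realType} {T : topologicalType} (f : T -> R * R) :
  continuous (fun x => (f x).1) -> continuous (fun x => (f x).2) ->
  continuous f.
Proof.
move=> f1 f2 x; rewrite (_ : f = fun y => ((f y).1, (f y).2)); last first.
  by apply/funext => y; case: (f y).
by apply: (@cvg_pair _ _ _ _ (nbhs (f x).1) (nbhs (f x).2)); [exact: f1|exact: f2].
Qed.

Lemma periodicz {R : realType} {T : Type} (f : R -> T) (L : R) (n : int) (s : R) :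
  (forall s, f (s + L) = f s) -> f (s + n%:~R * L) = f s.
Proof.
move=> fL; have fn (m : nat) t : f (t + m%:R * L) = f t.
  elim: m => [|m IH]; first by rewrite mul0r addr0.
  by rewrite -addn1 natrD mulrDl mul1r addrA fL.
by case: n => m; [exact: fn|rewrite NegzE mulrNz mulNr -[LHS](fn m.+1) subrK].
Qed.

Lemma period_representative {R : realType} (L a s : R) : 0 < L ->
  exists n : int, a <= s + n%:~R * L < a + L.
Proof.
move=> L0; exists (- Num.floor ((s - a) / L)).
have /andP[] := floor_itv ((s - a) / L); set m := Num.floor _.
rewrite ler_pdivlMr// ltr_pdivrMr// intrD mulrDl (_ : 1%:~R = 1 :> R)// mul1r.
by rewrite mulrNz mulNr => h1 h2; apply/andP; split; lra.
Qed.

Lemma ball_convex {R : realType} {V : normedModType R} (c x y : V) (d t : R) :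
  ball c d x -> ball c d y -> 0 <= t <= 1 -> ball c d (x + t *: (y - x)).
Proof.
rewrite -!ball_normE /= => cx cy /andP[t0 t1].
have e : t *: (c - y) - t *: (c - x) = t *: (x - y).
  by rewrite -scalerBr; congr (_ *: _); rewrite opprB addrC addrA subrK.
have -> : c - (x + t *: (y - x)) = (1 - t) *: (c - x) + t *: (c - y).
  rewrite scalerBl scale1r -[in RHS]addrA [- _ + _]addrC e opprD addrA.
  by rewrite -scalerN opprB.
apply: (le_lt_trans (ler_normD _ _)); rewrite !normrZ.
rewrite (ger0_norm t0) ger0_norm ?subr_ge0//.
have [->|t0'] := eqVneq t 0; first by rewrite subr0 mul1r mul0r addr0.
have {}t0 : 0 < t by rewrite lt_neqAle eq_sym t0' t0.
nra.
Qed.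

Lemma clopen_line {R : realType} (A : set R) :
  open A -> open (~` A) -> A !=set0 -> forall s, A s.
Proof.
move=> oA oC A0 s.
have cT : connected [set: R] by apply/connected_intervalP.
have -> // : A = setT.
apply: cT => //; first by exists A => //; rewrite setTI.
by exists A; rewrite ?setTI//; rewrite -[A]setCK; exact: open_closedC.
Qed.

(** Along the path the preimages of [W] and of its interior coincide, so this set of times is open
    and closed in the unit interval, and it contains 0. *)
Lemma path_stays_inside {R : realType} {T : topologicalType} (W : set T)
    (f : R -> T) : closed W -> continuous f ->
  (forall t, 0 <= t <= 1 -> W (f t) -> W° (f t)) -> W (f 0) -> W° (f 1).
Proof.
move=> cW cf inn W0.
have I0 : [set` `[0 : R, 1]] 0 by rewrite /= in_itv /= lexx ler01.
have I1 : [set` `[0 : R, 1]] 1 by rewrite /= in_itv /= lexx ler01.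
suff : (`[0, 1]%classic `&` f @^-1` W) 1.
  by case=> _; apply: inn; rewrite ler01 lexx.
rewrite (_ : _ `&` _ = `[0, 1]%classic)//; apply: (@segment_connected R 0 1).
- by exists 0.
- exists (f @^-1` W°).
    by apply: open_comp; [move=> x _; exact: cf|exact: open_interior].
  apply/seteqP; split=> t [It]; last by move=> /interior_subset.
  by move=> /inn; rewrite /= in_itv /= in It; move=> /(_ It).
- by exists (f @^-1` W) => //; apply: preimage_closed => // x _; exact: cf.
Qed.

(** * Sides of a simple closed curve *)

Section PlaneCurve.
Context {R : realType}.
Variables g dg : R -> R * R.
Hypothesis g1 : forall s : R, is_derive s 1 (fun k => (g k).1) (dg s).1.
Hypothesis g2 : forall s : R, is_derive s 1 (fun k => (g k).2) (dg s).2.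
Hypothesis dg_continuous : continuous dg.

Lemma curve_continuous : continuous g.
Proof.
apply: continuous_pair => s.
- by have /derivable1_diffP/differentiable_continuous := @ex_derive _ _ _ _ _ _ _ (g1 s).
- by have /derivable1_diffP/differentiable_continuous := @ex_derive _ _ _ _ _ _ _ (g2 s).
Qed.

Lemma is_derive_det w (s : R) :
  is_derive s 1 (fun k => det w (g k)) (det w (dg s)).
Proof.
by apply: (@is_derive_eq _ _ _ _ _ _ (w.1 *: (dg s).2 - w.2 *: (dg s).1)).
Qed.

(** By the mean value theorem the increment is [det w (dg c)] times [s' - s], and this factor keeps
    its sign for all [w] near [w0] and [c] near [s0]. Uniformity in [w] is needed because the
    direction changes from chord to chord. *)
Lemma det_mono s0 w0 : det w0 (dg s0) != 0 ->
  exists2 d, 0 < d & forall s s' w, ball s0 d s -> ball s0 d s' ->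
    ball w0 d w -> s < s' -> 0 < det w0 (dg s0) * det w (g s' - g s).
Proof.
set k := det w0 (dg s0) => k0.
have cv : k * det x.1 (dg x.2) @[x --> (w0, s0)] --> k * k.
  apply: cvgM; first exact: cvg_cst.
  apply: cvg_det; first exact: cvg_fst.
  have c2 : x.2 @[x --> (w0, s0)] --> s0 by exact: cvg_snd.
  exact: (cvg_comp _ _ c2 (@dg_continuous s0)).
have : \forall x \near (w0, s0), 0 < k * det x.1 (dg x.2).
  by apply: (cvgr_gt _ cv); rewrite -expr2 exprn_even_gt0.
move=> /nbhs_ballP[d /= d0 dP]; exists d => // s s' w bs bs' bw ss'.
have [|c] := MVT ss' (fun x _ => is_derive_det w x).
  apply: continuous_subspaceT => x.
  by apply: cvg_det; [exact: cvg_cst|exact: curve_continuous].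
rewrite in_itv /= => /andP[sc cs'] e.
have -> : det w (g s' - g s) = det w (g s') - det w (g s).
  by rewrite /det !pairE; ring.
rewrite e mulrA mulr_gt0 ?subr_gt0//; apply: (dP (w, c)); split => //=.
move: bs bs'; rewrite /ball /= !ltr_norml; lra.
Qed.

(* The intermediate value theorem replaces the inverse function theorem here. *)
Lemma curve_hit s0 w0 d : det w0 (dg s0) != 0 -> 0 < d ->
  \forall x \near ((g s0, w0) : (R * R) * (R * R)), dot x.2 x.2 = 1 ->
    exists s t : R, [/\ ball s0 d s, ball 0 d t & x.1 = g s + t *: x.2].
Proof.
move=> k0 d0; have [d1 d10 mono] := det_mono k0.
have cg := curve_continuous.
(* The offset [t] will be this dot product; it tends to 0 and so stays within [d]. *)
have cv : dot y.1.2 (y.1.1 - g y.2) @[y --> ((g s0, w0), s0)] --> (0 : R).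
  rewrite (_ : 0 = dot w0 (g s0 - g s0)); last by rewrite /dot subrr !mulr0 addr0.
  have c1 : y.1 @[y --> ((g s0, w0), s0)] --> (g s0, w0) by exact: cvg_fst.
  have c2 : y.2 @[y --> ((g s0, w0), s0)] --> s0 by exact: cvg_snd.
  apply: cvg_dot; first by apply: cvg_comp c1 _; exact: cvg_snd.
  apply: cvgB; first by apply: cvg_comp c1 _; exact: cvg_fst.
  exact: (cvg_comp _ _ c2 (cg s0)).
have /nbhs_ballP[d2 /= d20 dP] : \forall y \near ((g s0, w0), s0),
    ball 0 d (dot y.1.2 (y.1.1 - g y.2)).
  by apply: cv; exact: nbhsx_ballx.
pose e := Num.min (Num.min d d1) d2 / 2.
have [e0 ed ed1 ed2] : [/\ 0 < e, e < d, e < d1 & e < d2].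
  have : 0 < Num.min (Num.min d d1) d2 by rewrite !lt_min d0 d10 d20.
  have : Num.min (Num.min d d1) d2 <= d by rewrite !ge_min lexx.
  have : Num.min (Num.min d d1) d2 <= d1 by rewrite !ge_min lexx orbT.
  have : Num.min (Num.min d d1) d2 <= d2 by rewrite !ge_min lexx !orbT.
  by rewrite /e; split; lra.
set k := det w0 (dg s0) in k0 mono *.
have near_ball s r : `|s - s0| <= e -> e < r -> ball s0 r s.
  by move=> h1 h2; rewrite /ball /= distrC; exact: le_lt_trans h1 h2.
(* With [left], the determinant changes sign between [s0 - e] and [s0 + e]; its zero is the
   parameter [s] sought. *)
have right : \forall x \near (g s0, w0), 0 < k * det x.2 (g (s0 + e) - x.1).
  have c : k * det x.2 (g (s0 + e) - x.1) @[x --> (g s0, w0)] -->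
      k * det w0 (g (s0 + e) - g s0).
    apply: cvgM; first exact: cvg_cst.
    by apply: cvg_det; [|apply: cvgB; [exact: cvg_cst|exact: cvg_fst]];
      exact: cvg_snd.
  apply: (cvgr_gt _ c); apply: mono; last lra.
  - exact: ballxx.
  - by apply: near_ball => //; rewrite addrAC subrr add0r gtr0_norm.
  - exact: ballxx.
have left : \forall x \near (g s0, w0), 0 < k * det x.2 (x.1 - g (s0 - e)).
  have c : k * det x.2 (x.1 - g (s0 - e)) @[x --> (g s0, w0)] -->
      k * det w0 (g s0 - g (s0 - e)).
    apply: cvgM; first exact: cvg_cst.
    by apply: cvg_det; [|apply: cvgB; [exact: cvg_fst|exact: cvg_cst]];
      exact: cvg_snd.
  apply: (cvgr_gt _ c); apply: mono; last lra.
  - by apply: near_ball => //; rewrite addrAC subrr add0r normrN gtr0_norm.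
  - exact: ballxx.
  - exact: ballxx.
near=> x => ux.
have xr : 0 < k * det x.2 (g (s0 + e) - x.1) by near: x.
have xl : 0 < k * det x.2 (x.1 - g (s0 - e)) by near: x.
have xb : ball (g s0, w0) d2 x by near: x; exact: nbhsx_ballx.
have [|||s] := @IVT R (fun s => k * det x.2 (g s - x.1)) (s0 - e) (s0 + e) 0.
- lra.
- apply: continuous_subspaceT => s; apply: cvgM; first exact: cvg_cst.
  apply: cvg_det; first exact: cvg_cst.
  by apply: cvgB; [exact: cg|exact: cvg_cst].
- rewrite ge_min le_max (ltW xr) orbT andbT.
  rewrite (_ : k * _ = - (k * det x.2 (x.1 - g (s0 - e)))).
    by rewrite oppr_le0 (ltW xl).
  by rewrite /det !pairE; ring.
rewrite in_itv /= => /andP[s1 s2] /eqP.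
rewrite mulf_eq0 (negPf k0) /= => /eqP ds.
have sb : `|s - s0| <= e by rewrite ler_norml; lra.
have dx : det x.2 (x.1 - g s) = 0.
  by rewrite -[RHS]oppr0 -ds /det !pairE; ring.
exists s, (dot x.2 (x.1 - g s)); split.
- exact: near_ball.
- by apply: (dP (x, s)); split => //; exact: near_ball.
- by rewrite -det_eq0_dot// addrC subrK.
Unshelve. all: by end_near.
Qed.

Section SimpleClosed.
Variable L : R.
Hypothesis L0 : 0 < L.
Hypothesis gL : forall s, g (s + L) = g s.
Hypothesis g_inj : forall s s', g s = g s' -> `|s - s'| < L -> s = s'.

(** By injectivity the compact arc of parameters away from [s0], modulo the period, misses [g s0],
    hence misses a neighbourhood of it. Far parts of the curve therefore cannot interfere with local
    arguments. *)
Lemma near_curve_point s0 d : 0 < d ->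
  \forall z \near g s0, forall s, g s = z -> exists2 s', ball s0 d s' & g s' = z.
Proof.
move=> d0; have cg := curve_continuous.
pose K := `[s0 + d / 2, s0 + L - d / 2].
have gK : closed (g @` [set` K]).
  apply: compact_closed; first exact: norm_hausdorff.
  apply: continuous_compact; last exact: segment_compact.
  exact: continuous_subspaceT.
have : nbhs (g s0) (~` (g @` [set` K])).
  apply: open_nbhs_nbhs; split; first exact: closed_openC.
  move=> [s]; rewrite /= in_itv /= => /andP[s1 s2] gs.
  have : s = s0 by apply: g_inj => //; rewrite ltr_norml; lra.
  lra.
apply: filterS => z nz s gs.
have [n] := period_representative (s0 - d / 2) s L0.
set s' := s + _ => /andP[s1 s2].
have gs' : g s' = z by rewrite /s' periodicz.
exists s' => //; rewrite /ball /= distrC ltr_norml.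
have [?|s3] := ltP s' (s0 + d / 2); first lra.
by exfalso; apply: nz; exists s' => //; rewrite /= in_itv /=; lra.
Qed.

(** A hit on the curve would, by [near_curve_point], have its parameter near [s0]. The displacement
    between the two curve points would then be parallel to the direction, against the strict sign in
    [det_mono]. *)
Lemma curve_off s0 w0 : det w0 (dg s0) != 0 ->
  \forall x \near ((s0, w0), (0 : R)), x.2 != 0 ->
    forall s, g x.1.1 + x.2 *: x.1.2 <> g s.
Proof.
move=> k0; have [d d0 mono] := det_mono k0.
have cg := curve_continuous.
have c : g x.1.1 + x.2 *: x.1.2 @[x --> ((s0, w0), (0 : R))] --> g s0.
  rewrite -[X in _ --> X]addr0 -(scale0r w0).
  have c1 : x.1 @[x --> ((s0, w0), (0 : R))] --> (s0, w0) by exact: cvg_fst.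
  apply: cvgD; last first.
    apply: cvgZ; first exact: cvg_snd.
    by apply: cvg_comp c1 _; exact: cvg_snd.
  have c2 : x.1.1 @[x --> ((s0, w0), (0 : R))] --> s0.
    by apply: cvg_comp c1 _; exact: cvg_fst.
  exact: (cvg_comp _ _ c2 (cg s0)).
have nr := c _ (near_curve_point s0 d0).
near=> x => x0 s e.
have /(_ s (esym e))[s' bs' gs'] : forall s, g s = g x.1.1 + x.2 *: x.1.2 ->
  exists2 s', ball s0 d s' & g s' = g x.1.1 + x.2 *: x.1.2 by near: x.
have [[bx bw] _] : ball ((s0, w0), (0 : R)) d x by near: x; exact: nbhsx_ballx.
have d0' : det x.1.2 (g s' - g x.1.1) = 0.
  by rewrite gs' /det !pairE; ring.
have [ss|ss|ss] := ltgtP s' x.1.1.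
- have := mono _ _ _ bs' bx bw ss.
  rewrite (_ : det _ (g _ - _) = - det x.1.2 (g s' - g x.1.1)).
    by rewrite d0' oppr0 mulr0 ltxx.
  by rewrite /det !pairE; ring.
- by have := mono _ _ _ bx bs' bw ss; rewrite d0' mulr0 ltxx.
(* If the parameters agree, the direction is 0; the strict inequality of [det_mono] rules out 0 from
   the ball around [w0]. *)
- have w10 : x.1.2 = 0.
    apply/eqP; move/eqP: gs'; rewrite ss -subr_eq0 opprD addrA subrr add0r.
    by rewrite oppr_eq0 scaler_eq0 (negPf x0).
  have h : ball s0 d (s0 + d / 2).
    by rewrite /ball /= opprD addrA subrr add0r normrN gtr0_norm; lra.
  have : s0 < s0 + d / 2 by lra.
  move=> /(mono _ _ _ (ballxx s0 d0) h bw).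
  by rewrite w10 /det /= !mul0r subr0 mulr0 ltxx.
Unshelve. all: by end_near.
Qed.

Section RegularDomain.
Variable W : set (R * R).
Hypothesis W_compact : compact W.
Hypothesis W_regular : W `<=` closure W°.
Hypothesis W_boundary : W `\` W° = range g.

Let W_closed : closed W.
Proof. by apply: compact_closed => //; exact: norm_hausdorff. Qed.

Lemma boundary_curve z : W z -> (forall s, z <> g s) -> W° z.
Proof.
move=> Wz zg; apply: contrapT => nz.
have : (W `\` W°) z by [].
by rewrite W_boundary => -[s _ /esym]; exact: zg.
Qed.

Lemma curve_in s : W (g s).
Proof.
have : (W `\` W°) (g s) by rewrite W_boundary; exists s.
by case.
Qed.

Lemma curve_notin_interior s : ~ W° (g s).
Proof.
have : (W `\` W°) (g s) by rewrite W_boundary; exists s.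
by case.
Qed.

(** The points pushed off the curve to one side come from a convex set of parameters and avoid the
    curve, so they lie all in the interior of [W] or all outside [W]. If both sides were inside,
    [g s0] would be interior; if neither were, [g s0] would not be a limit of interior points. *)
Lemma sides s0 w0 : dot w0 w0 = 1 -> det w0 (dg s0) != 0 ->
  exists2 b : R, b = 1 \/ b = -1 &
  \forall x \near ((s0, w0), (0 : R)), 0 < x.2 ->
    W° (g x.1.1 + (b * x.2) *: x.1.2) /\ ~ W (g x.1.1 - (b * x.2) *: x.1.2).
Proof.
move=> u0 k0; have cg := curve_continuous.
have /nbhs_ballP[d /= d0 off] :=
  curve_off k0.
pose P (b : R) (x : (R * (R * R)) * R) := g x.1.1 + (b * x.2) *: x.1.2.
have Pc b : continuous (P b).
  move=> x; have c1 : y.1 @[y --> x] --> x.1 by exact: cvg_fst.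
  have c2 : y.2 @[y --> x] --> x.2 by exact: cvg_snd.
  have c11 : y.1.1 @[y --> x] --> x.1.1 by apply: cvg_comp c1 _; exact: cvg_fst.
  apply: cvgD; first exact: (cvg_comp _ _ c11 (cg x.1.1)).
  apply: cvgZ; first by apply: cvgM; [exact: cvg_cst|].
  by apply: cvg_comp c1 _; exact: cvg_snd.
pose B := [set x : (R * (R * R)) * R | ball ((s0, w0), (0 : R)) d x /\ 0 < x.2].
have offP b x s : b = 1 \/ b = -1 -> B x -> P b x <> g s.
  move=> b1 [bx x0].
  apply: (off (x.1, b * x.2)) => /=.
    case: bx => b2 b3; split => //=; move: b3; rewrite /ball /= !sub0r !normrN.
    by rewrite normrM; case: b1 => ->; rewrite ?normrN normr1 mul1r.
  rewrite mulf_neq0//; last by rewrite gt_eqF.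
  by case: b1 => ->; rewrite ?oppr_eq0 oner_eq0.
(* Join the two parameters by a segment inside the convex set [B] and follow its image, which never
   touches the curve. *)
have one_side b x y : b = 1 \/ b = -1 -> B x -> B y -> W (P b x) -> W° (P b y).
  move=> b1 Bx By Wx.
  pose f (t : R) := P b (x + t *: (y - x)).
  have Bf t : 0 <= t <= 1 -> B (x + t *: (y - x)).
    move=> t01; split; first by apply: ball_convex => //; [case: Bx|case: By].
    case: Bx => _; case: By => _ /=; move: t01 => /andP[].
    rewrite /GRing.scale /=; nra.
  have -> : y = x + (1 : R) *: (y - x) by rewrite scale1r addrC subrK.
  apply: (@path_stays_inside _ _ W f) => //.
  - move=> t.
    have c : x + r *: (y - x) @[r --> t] --> x + t *: (y - x).
      by apply: cvgD; [exact: cvg_cst|apply: cvgZ; [exact: cvg_id|exact: cvg_cst]].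
    exact: (cvg_comp _ _ c (@Pc b _)).
  - by move=> t t01 Wf; apply: boundary_curve => // s; apply: offP => //; exact: Bf.
  - by rewrite /f scale0r addr0.
have Bc : B ((s0, w0), d / 2).
  split; last by rewrite /=; lra.
  split; first exact: ballxx.
  by rewrite /ball /= sub0r normrN gtr0_norm; lra.
(* Sliding in the fixed direction [w0] shows that every point near [g s0] lies on the curve or on
   one of its two sides. *)
have cover : \forall z \near g s0, exists s t : R,
    [/\ ball s0 d s, ball 0 d t & z = g s + t *: w0].
  have /nbhs_ballP[e /= e0 h] := curve_hit k0 d0.
  apply/nbhs_ballP; exists e => //= z bz.
  by apply: (h (z, w0)) => //; split => //; exact: ballxx.
have cov (s t : R) : ball s0 d s -> ball 0 d t -> 0 < t -> B ((s, w0), t).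
  by move=> bs bt t0; split => //; split => //; split => //; exact: ballxx.
have ball0N (t : R) : ball (0 : R) d t -> ball (0 : R) d (- t).
  by rewrite /ball /= !sub0r !normrN.
have good b : b = 1 \/ b = -1 -> W (P b ((s0, w0), d / 2)) ->
    ~ W (P (- b) ((s0, w0), d / 2)) ->
  exists2 b : R, b = 1 \/ b = -1 &
  \forall x \near ((s0, w0), (0 : R)), 0 < x.2 ->
    W° (g x.1.1 + (b * x.2) *: x.1.2) /\ ~ W (g x.1.1 - (b * x.2) *: x.1.2).
  move=> b1 Wp Wn; exists b => //.
  have b1' : - b = 1 \/ - b = -1 by case: b1 => ->; rewrite ?opprK; [right|left].
  apply/nbhs_ballP; exists d => //= x bx x0; split; first exact: (one_side b _ x b1 Bc (conj bx x0) Wp).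
  move=> Wx; apply: Wn; apply: interior_subset; apply: (one_side (- b) x _ b1' (conj bx x0) Bc).
  by rewrite /P mulNr scaleNr.
have [Wp|Wp] := pselect (W (P 1 ((s0, w0), d / 2)));
  have [Wn|Wn] := pselect (W (P (- 1) ((s0, w0), d / 2))).
- exfalso; apply: (@curve_notin_interior s0).
  rewrite /interior; near=> z.
  have [s [t [bs bt ->]]] : exists s t : R,
    [/\ ball s0 d s, ball 0 d t & z = g s + t *: w0] by near: z.
  have [t0|t0|->] := ltgtP t 0; last by rewrite scale0r addr0; exact: curve_in.
  + have := one_side (-1) _ _ (or_intror erefl) Bc
      (cov s (- t) bs (ball0N _ bt) _) Wn.
    by rewrite oppr_gt0 /P mulrNN mul1r => /(_ t0)/interior_subset.
  + have := one_side 1 _ _ (or_introl erefl) Bc (cov s t bs bt t0) Wp.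
    by rewrite /P mul1r => /interior_subset.
- by apply: (good 1) => //; left.
- by apply: (good (- 1)); rewrite ?opprK //; right.
- exfalso; have [z [Wz [s [t [bs bt e]]]]] := W_regular (curve_in s0) cover.
  have [t0|t0|t0] := ltgtP t 0; last 1 first.
  + by move: Wz; rewrite e t0 scale0r addr0; exact: curve_notin_interior.
  + apply: Wn; apply: interior_subset.
    apply: (one_side (-1) ((s, w0), - t)) => //; first by right.
      by apply: cov => //; [exact: ball0N|rewrite oppr_gt0].
    by rewrite /P /= mulrNN mul1r -e; exact: interior_subset.
  + apply: Wp; apply: interior_subset.
    apply: (one_side 1 ((s, w0), t)) => //; [by left|exact: cov|].
    by rewrite /P /= mul1r -e; exact: interior_subset.
Unshelve. all: by end_near.
Qed.

(** * A global choice of the inward direction *)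

Section InwardField.
Variable V : R -> R * R.
Hypothesis V_continuous : continuous V.
Hypothesis V_unit : forall s, dot (V s) (V s) = 1.
Hypothesis V_transverse : forall s, det (V s) (dg s) != 0.

Let inward b s0 := \forall x \near ((s0, V s0), (0 : R)), 0 < x.2 ->
  W° (g x.1.1 + (b * x.2) *: x.1.2) /\ ~ W (g x.1.1 - (b * x.2) *: x.1.2).

(** What holds on a neighbourhood of a point holds on neighbourhoods of nearby points. This applies
    along [V] because start, direction and offset vary together in [inward]. *)
Lemma inward_open b : open [set s | inward b s].
Proof.
rewrite openE => s /=; rewrite /inward => /nbhs_interior h.
have c : ((s', V s'), (0 : R)) @[s' --> s] --> ((s, V s), (0 : R)).
  apply: (@cvg_pair _ _ _ _ (nbhs (s, V s)) (nbhs (0 : R))); last exact: cvg_cst.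
  by apply: (@cvg_pair _ _ _ _ (nbhs s) (nbhs (V s)));
    [exact: cvg_id|exact: V_continuous].
exact: c _ h.
Qed.

Lemma inward_excl s : inward 1 s -> ~ inward (- 1) s.
Proof.
rewrite /inward => h1 h2.
have [d /= d0 h] := (nbhs_ballP ((s, V s), (0 : R)) _).1 (filterI h1 h2).
have [] := h ((s, V s), d / 2).
  split; first exact: ballxx.
  by rewrite /ball /= sub0r normrN gtr0_norm; lra.
rewrite /= => Wp; have d20 : 0 < d / 2 by lra.
move: Wp => /(_ d20)[/interior_subset Wp _] /(_ d20)[_].
by rewrite mulN1r scaleNr opprK -[X in X *: _]mul1r.
Qed.

Lemma inward_sign : exists2 b : R, b = 1 \/ b = -1 &
  forall s0, \forall x \near ((s0, b *: V s0), (0 : R)), 0 < x.2 ->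
    W° (g x.1.1 + x.2 *: x.1.2) /\ ~ W (g x.1.1 - x.2 *: x.1.2).
Proof.
have side s : inward 1 s \/ inward (- 1) s.
  have [b [->|->] h] := sides (V_unit s) (V_transverse s); by [left|right].
have [b b1 bP] : exists2 b : R, b = 1 \/ b = -1 & forall s, inward b s.
  have [[s0 h0]|no] := pselect (exists s, inward 1 s).
    exists 1; first by left.
    apply: clopen_line; [exact: inward_open| |by exists s0].
    rewrite (_ : ~` _ = [set s | inward (- 1) s]); first exact: inward_open.
    apply/seteqP; split => s /= h; first by case: (side s).
    by move=> /inward_excl.
  exists (- 1) => [|s]; first by right.
  by case: (side s) => // h; exfalso; apply: no; exists s.
have bb : b * b = 1 by case: b1 => ->; rewrite ?mulrNN mulr1.
exists b => // s0.
(* Since [b * b = 1], replacing the direction by its multiple by [b] absorbs the sign of the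
   offset. *)
have c : ((x.1.1, b *: x.1.2), x.2) @[x --> ((s0, b *: V s0), (0 : R))]
    --> ((s0, V s0), (0 : R)).
  rewrite -{2}[V s0]scale1r -bb -scalerA.
  have c1 : x.1 @[x --> ((s0, b *: V s0), (0 : R))] --> (s0, b *: V s0).
    exact: cvg_fst.
  have c11 : x.1.1 @[x --> ((s0, b *: V s0), (0 : R))] --> s0.
    by apply: cvg_comp c1 _; exact: cvg_fst.
  have c12 : x.1.2 @[x --> ((s0, b *: V s0), (0 : R))] --> b *: V s0.
    by apply: cvg_comp c1 _; exact: cvg_snd.
  apply: (@cvg_pair _ _ _ _ (nbhs (s0, _)) (nbhs (0 : R))); last exact: cvg_snd.
  apply: (@cvg_pair _ _ _ _ (nbhs s0) (nbhs _)); first exact: c11.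
  by apply: cvgZ; [exact: cvg_cst|exact: c12].
have : \forall x \near ((s0, b *: V s0), (0 : R)), 0 < x.2 ->
    W° (g x.1.1 + (b * x.2) *: (b *: x.1.2)) /\
    ~ W (g x.1.1 - (b * x.2) *: (b *: x.1.2)) := c _ (bP s0).
apply: filterS => -[[s w] t] /= h t0.
by have := h t0; rewrite scalerA mulrAC bb mul1r.
Qed.

End InwardField.

(** * Chords and the exit map *)

Section Chords.
Variables (w : R -> R * R) (u : R * R -> R).
Hypothesis w_continuous : continuous w.
Hypothesis w_unit : forall s, dot (w s) (w s) = 1.
Hypothesis w_transverse : forall s, det (w s) (dg s) != 0.
Hypothesis w_point : forall s s', g s = g s' -> w s = w s'.
Hypothesis w_inward : forall s0, \forall x \near ((s0, w s0), (0 : R)), 0 < x.2 ->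
  W° (g x.1.1 + x.2 *: x.1.2) /\ ~ W (g x.1.1 - x.2 *: x.1.2).

Definition ray_inside s t := forall r : R, 0 <= r <= t -> W (g s + r *: w s).

Hypothesis u_ray : forall s t, 0 <= t -> ray_inside s t ->
  u (g s + t *: w s) - u (g s) = t * det (g s) (w s) / 2.
Hypothesis w_ray : forall s s' t, 0 < t -> ray_inside s t ->
  g s' = g s + t *: w s -> w s' = w s \/ w s' = - w s.

(** The segment need only stay in [W]; that it avoids the boundary between its ends is proved in
    [chord_interior]. *)
Definition chord s s' t :=
  [/\ 0 < t, g s' = g s + t *: w s & ray_inside s t].

Lemma inward_ray s : exists2 d : R, 0 < d & forall r, 0 < r < d ->
  W° (g s + r *: w s) /\ ~ W (g s - r *: w s).
Proof.
have /nbhs_ballP[d /= d0 h] := w_inward s; exists d => // r /andP[r0 rd].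
apply: (h ((s, w s), r)) => //; split; first exact: ballxx.
by rewrite /ball /= sub0r normrN gtr0_norm.
Qed.

(** If the inward direction at the end were again [w s], the points just before the end would lie
    outside [W], yet the chord passes through them. *)
Lemma chord_reverse s s' t : chord s s' t -> w s' = - w s.
Proof.
move=> [t0 gs' ins]; have [ww|//] := w_ray t0 ins gs'.
have [d d0 h] := inward_ray s'.
pose r := Num.min (d / 2) t.
have [r0 rd rt] : [/\ 0 < r, r < d & r <= t].
  split; first by rewrite lt_min t0 andbT; lra.
    by rewrite gt_min; apply/orP; left; lra.
  by rewrite ge_min lexx orbT.
have [|_ []] := h r; first by rewrite r0.
rewrite gs' ww -addrA -scalerBl; apply: ins; lra.
Qed.

(** A boundary point in between would end a shorter chord. By [chord_reverse] its inward direction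
    would be [- w s], so the original chord would be outside [W] just beyond it. *)
Lemma chord_interior s s' t r : chord s s' t -> 0 < r < t ->
  W° (g s + r *: w s).
Proof.
move=> [t0 gs' ins] /andP[r0 rt].
apply: boundary_curve; first by apply: ins; lra.
move=> s'' /esym e.
have /chord_reverse ww : chord s s'' r.
  by split => // q /andP[q0 q1]; apply: ins; lra.
have [d d0 h] := inward_ray s''.
pose q := Num.min (d / 2) (t - r).
have [q0 qd qt] : [/\ 0 < q, q < d & q <= t - r].
  split; first by rewrite lt_min; lra.
    by rewrite gt_min; apply/orP; left; lra.
  by rewrite ge_min lexx orbT.
have [|_ []] := h q; first by rewrite q0.
rewrite e ww scalerN opprK -addrA -scalerDl; apply: ins; lra.
Qed.

(** Otherwise the end of the shorter chord would be a boundary point in the interior of the longer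
    one. *)
Lemma chord_length_unique s s1 s2 t1 t2 :
  chord s s1 t1 -> chord s s2 t2 -> t1 = t2.
Proof.
wlog lt12 : s1 s2 t1 t2 / t1 < t2 => [hw c1 c2|c1 c2].
  by have [l|l|//] := ltgtP t1 t2; [exact: hw l c1 c2|rewrite (hw _ _ _ _ l c2 c1)].
case: c1 => t0 gs1 _.
have /(chord_interior c2) : 0 < t1 < t2 by rewrite t0.
by rewrite -gs1 => /curve_notin_interior.
Qed.

Lemma chord_sym s s' t : chord s s' t -> chord s' s t.
Proof.
move=> c; have ww := chord_reverse c; case: c => t0 gs' ins; split => //.
  by rewrite ww gs' scalerN addrK.
move=> r rt; rewrite ww gs' scalerN -addrA -scalerBl; apply: ins; lra.
Qed.

Lemma chord_exists s : exists s' t, chord s s' t /\ s < s' < s + L.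
Proof.
have [d d0 dP] := inward_ray s.
pose f (r : R) := g s + r *: w s.
have cf : continuous f.
  by move=> r; apply: cvgD; [exact: cvg_cst|apply: cvgZ; [exact: cvg_id|exact: cvg_cst]].
have [z0 Wz0 z0max] : exists2 z, z \in W &
    forall z', z' \in W -> dot (w s) z' <= dot (w s) z.
  apply: compact_EVT_max => //; first by exists (g s); exact: curve_in.
  by apply: continuous_subspaceT => z; apply: cvg_dot; [exact: cvg_cst|exact: cvg_id].
(* From this time on, the component of the ray along [w s] exceeds its maximum over the compact set
   [W]. *)
pose M := dot (w s) z0 - dot (w s) (g s) + 1.
have fM r : M <= r -> ~ W (f r).
  move=> Mr /mem_set/z0max.
  have -> : dot (w s) (f r) = dot (w s) (g s) + r * dot (w s) (w s).
    by rewrite /f /dot !pairE; ring.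
  by rewrite w_unit mulr1 leNgt => /negP[]; rewrite -subr_gt0; move: Mr; rewrite /M; lra.
pose N := Num.max M d.
have NM : M <= N by rewrite le_max lexx.
have Nd : d <= N by rewrite le_max lexx orbT.
(* The exit time is the least element of [K]. Starting at [d / 2] leaves out the initial point,
   which is itself not interior. *)
pose K := [set` `[d / 2, N]] `&` f @^-1` (~` W°).
have cK : compact K.
  apply: compact_closedI; first exact: segment_compact.
  apply: preimage_closed; first by move=> x _; exact: cf.
  by apply: open_closedC; exact: open_interior.
have [t tK tmin] : exists2 t, t \in K & forall r, r \in K -> t <= r.
  apply: (@compact_EVT_min _ _ id) => //.
    exists N; split; first by rewrite /= in_itv /=; lra.
    by move=> /interior_subset; exact: fM.
  by apply: continuous_subspaceT => z; exact: cvg_id.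
move: tK => /set_mem[]; rewrite /= in_itv /= => /andP[td tN] nWt.
have inn r : 0 < r < t -> W° (f r).
  move=> /andP[r0 rt]; have [rd|rd] := ltP r d; first by apply dP; rewrite r0.
  apply: contrapT => nW; have : r \in K by apply/mem_set; split => //=; rewrite in_itv /=; lra.
  by move/tmin; lra.
(* The exit point is a limit of the interior points before it, and [W] is closed. *)
have Wt : W (f t).
  apply: contrapT => nW.
  have : nbhs t (f @^-1` (~` W)).
    by apply: cf; apply: open_nbhs_nbhs; split => //; exact: closed_openC W_closed.
  move=> /nbhs_ballP[e /= e0 he].
  pose r := Num.max (t / 2) (t - e / 2).
  have [r1 r2] : t / 2 <= r /\ t - e / 2 <= r by rewrite !le_max !lexx orbT.
  have rt : r < t by rewrite gt_max; lra.
  apply: (he r); last by apply: interior_subset; apply: inn; lra.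
  by rewrite /ball /= ltr_norml; lra.
have : (W `\` W°) (f t) by [].
rewrite W_boundary => -[s1 _ gs1].
have [n] := period_representative s s1 L0; set s' := s1 + _ => /andP[ss' s'L].
have gs' : g s' = f t by rewrite /s' periodicz.
have t0 : 0 < t by lra.
exists s', t; split; last first.
  rewrite s'L andbT lt_neqAle ss' andbT; apply/eqP => e.
  have : t * dot (w s) (w s) = dot (w s) (f t - g s).
    by rewrite /f /dot !pairE; ring.
  rewrite -gs' -e w_unit subrr /dot !mulr0 addr0 mulr1; lra.
split => // r /andP[]; rewrite le_eqVlt => /orP[/eqP <- _|r0].
  by rewrite scale0r addr0; exact: curve_in.
rewrite le_eqVlt => /orP[/eqP -> //|rt].
by apply: interior_subset; apply: inn; rewrite r0.
Qed.

Lemma chord_end_unique s s1 s2 t1 t2 : chord s s1 t1 -> chord s s2 t2 ->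
  s < s1 < s + L -> s < s2 < s + L -> s1 = s2.
Proof.
move=> c1 c2 b1 b2; have tt := chord_length_unique c1 c2.
case: c1 c2 => _ g1' _ [_ g2' _]; apply: g_inj; first by rewrite g1' g2' tt.
by rewrite ltr_norml; lra.
Qed.

Section EndMap.
Variables e T : R -> R.
Hypothesis eP : forall s, chord s (e s) (T s) /\ s < e s < s + L.

Lemma end_shift s : e (s + L) = e s + L.
Proof.
have [c b] := eP (s + L); have [[t0 ge ins] b'] := eP s.
have gg := gL s; have ww := w_point gg.
apply: (chord_end_unique c (t2 := T s)) => //; last lra.
by split => //; [rewrite gL gg ww|move=> r rt; rewrite gg ww; exact: ins].
Qed.

(** Read backwards, the two chords start at one point and so have one length and one end. Both
    parameters lie within one period below the common value, where [g] is injective. *)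
Lemma end_inj s1 s2 : e s1 = e s2 -> s1 = s2.
Proof.
move=> ee; have [/chord_sym c1 b1] := eP s1; have [/chord_sym c2 b2] := eP s2.
rewrite ee in c1 b1; have tt := chord_length_unique c1 c2.
case: c1 c2 => _ g1' _ [_ g2' _]; apply: g_inj; first by rewrite g1' g2' tt.
by rewrite ltr_norml; lra.
Qed.

(** For [s] near [s0] a chord with end parameter near [e s0] is built in three pieces and is the
    chord of [s] by uniqueness. Inwardness at [s0] covers the start, compactness of the middle of
    the old chord covers the middle, and inwardness at [e s0] covers the end. *)
Lemma end_continuous : continuous e.
Proof.
have cg := curve_continuous.
suff main (s0 : R) : e s @[s --> s0] --> e s0 by exact: main.
have [ch0 b0] := eP s0; have wr := chord_reverse ch0.
have [T0 ge0 ins0] := ch0.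
apply/cvgrPdist_lt => eta eta0.
have /nbhs_ballP[d1 /= d10 in1] := w_inward s0.
have /nbhs_ballP[d2 /= d20 in2] := w_inward (e s0); rewrite wr in in2.
(* [d] is small enough for the three pieces to overlap and for the new end parameter to stay between
   [s] and [s + L]. *)
have [d d0 [[dd1 dd2] [deta dT] [de1 de2]]] : exists2 d : R, 0 < d &
    [/\ 2 * d <= d1 /\ 2 * d <= d2, 2 * d <= eta /\ 2 * d <= T s0 &
        2 * d <= e s0 - s0 /\ 2 * d <= s0 + L - e s0].
  pose m := Num.min (Num.min d1 d2) (Num.min (Num.min eta (T s0))
    (Num.min (e s0 - s0) (s0 + L - e s0))).
  have m0 : 0 < m by rewrite !lt_min d10 d20 eta0 T0 /=; lra.
  exists (m / 2); first lra.
  by rewrite [2 * _]mulrC divfK ?pnatr_eq0// !ge_min !lexx !orbT.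
have cray (r : R) : g x.2 + x.1 *: w x.2 @[x --> (r, s0)] --> g s0 + r *: w s0.
  have c1 : x.1 @[x --> (r, s0)] --> r by exact: cvg_fst.
  have c2 : x.2 @[x --> (r, s0)] --> s0 by exact: cvg_snd.
  apply: cvgD; first exact: (cvg_comp _ _ c2 (cg s0)).
  by apply: cvgZ => //; exact: (cvg_comp _ _ c2 (@w_continuous s0)).
have tube : \forall s \near s0, forall r, d / 2 <= r <= T s0 - d / 2 ->
    W (g s + r *: w s).
  have cK := (compact_near_coveringP _).1 (@segment_compact R (d / 2) (T s0 - d / 2)).
  have : \forall s \near s0, [set` `[d / 2, T s0 - d / 2]] `<=`
      [set r | W (g s + r *: w s)].
    apply: (cK R (nbhs s0) (fun s r => W (g s + r *: w s))) => r.
    rewrite /= in_itv /= => rI.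
    have nW : nbhs (g s0 + r *: w s0) W.
      by apply: (chord_interior ch0); lra.
    exact: (cray r _ nW).
  by apply: filterS => s h r rI; apply: h; rewrite /= in_itv.
(* The point at the old length need not lie on the boundary; a small correction [t] along [w s] puts
   it there. *)
have hit : \forall s \near s0, exists s' t : R,
    [/\ ball (e s0) (d / 2) s', ball 0 (d / 2) t &
        g s + T s0 *: w s = g s' + t *: w s].
  have k0 : det (w s0) (dg (e s0)) != 0.
    have -> : w s0 = - w (e s0) by rewrite wr opprK.
    rewrite (_ : det _ _ = - det (w (e s0)) (dg (e s0))) ?oppr_eq0//.
    by rewrite /det !pairE; ring.
  have d20' : 0 < d / 2 by lra.
  have h := curve_hit k0 d20'.
  have c : (g s + T s0 *: w s, w s) @[s --> s0] --> (g (e s0), w s0).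
    apply: (@cvg_pair _ _ _ _ (nbhs _) (nbhs (w s0))); last exact: w_continuous.
    rewrite ge0; apply: cvgD; first exact: cg.
    by apply: cvgZ; [exact: cvg_cst|exact: w_continuous].
  have : \forall s \near s0, dot (w s) (w s) = 1 -> exists s' t : R,
    [/\ ball (e s0) (d / 2) s', ball 0 (d / 2) t &
        g s + T s0 *: w s = g s' + t *: w s] := c _ h.
  by apply: filterS => s; apply.
have nb : \forall s \near s0, ball s0 d s.
  exact: near_ball.
have nw : \forall s \near s0, ball (w s0) d (w s).
  by apply: w_continuous; exact: nbhsx_ballx.
near=> s.
have [s' [t [bs' bt eq]]] : exists s' t : R,
    [/\ ball (e s0) (d / 2) s', ball 0 (d / 2) t &
        g s + T s0 *: w s = g s' + t *: w s] by near: s.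
have tubes : forall r, d / 2 <= r <= T s0 - d / 2 -> W (g s + r *: w s) by near: s.
have bs : ball s0 d s by near: s.
have bw : ball (w s0) d (w s).
  by near: s.
have {}eq : g s' = g s + (T s0 - t) *: w s.
  by rewrite scalerBl addrA eq addrK.
move: bs bs' bt; rewrite /ball /= !ltr_norml => bs bs' bt.
suff -> : e s = s' by lra.
have [c b] := eP s.
apply: (chord_end_unique c (t2 := T s0 - t)) => //; last by lra.
split => //; first lra.
move=> r /andP[]; rewrite le_eqVlt => /orP[/eqP <- _|r0].
  by rewrite scale0r addr0; exact: curve_in.
rewrite le_eqVlt => /orP[/eqP ->|rt].
  by rewrite -eq; exact: curve_in.
have [rd|rd] := ltP r d.
  have [||/interior_subset //] := in1 ((s, w s), r); last by [].
  split; [split => /=|]; rewrite /ball /=; last by rewrite ltr_norml; lra.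
    by rewrite ltr_norml; lra.
  by apply: le_ball bw; lra.
have [rT|rT] := leP r (T s0 - d / 2); first by apply: tubes; lra.
(* Near the end, the position is measured backwards from the exit point [g s'], in the direction
   [- w s]. *)
rewrite (_ : r = (T s0 - t) - (T s0 - t - r)); last by ring.
rewrite scalerBl addrA -eq -scalerN.
have [||/interior_subset //] := in2 ((s', - w s), T s0 - t - r); last by rewrite /=; lra.
split; [split => /=|]; last by rewrite /ball /= ltr_norml; lra.
  by rewrite /ball /= ltr_norml; lra.
apply: (@le_ball _ _ _ d); first lra.
by move: bw; rewrite -!ball_normE /= -opprD normrN.
Unshelve. all: by end_near.
Qed.

(** A continuous injection of the line is strictly monotone, and [end_shift] excludes a decreasing
    one. *)
Lemma end_increasing s1 s2 : s1 < s2 -> e s1 < e s2.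
Proof.
have [||inc|dec] := @itv_continuous_inj_mono R e `]-oo, +oo[.
- by apply: continuous_subspaceT; exact: end_continuous.
- by move=> x y _ _; exact: end_inj.
- by apply: inc; rewrite in_itv.
- exfalso; have [_ b] := eP 0.
  have : e L < e 0 by apply: dec; rewrite ?in_itv.
  by rewrite -[L]add0r end_shift; lra.
Qed.

(* The transversality sign is constant along the boundary, but the chord arrives
   at [e s] with the direction opposite to the inward one. *)
Lemma end_transverse_sign s :
  det (w s) (dg s) * det (w s) (dg (e s)) < 0.
Proof.
have [/chord_reverse wr _] := eP s.
pose k r := det (w r) (dg r); have k0 r : k r != 0 by exact: w_transverse.
have ck : continuous (fun r => k s * k r).
  move=> r; apply: cvgM; first exact: cvg_cst.
  by apply: cvg_det; [exact: w_continuous|exact: dg_continuous].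
have pos : forall r, [set r | 0 < k s * k r] r.
  apply: clopen_line.
  - apply: (@open_comp _ _ (fun r => k s * k r) [set x | 0 < x]) => [r _|].
      exact: ck.
    exact: open_gt.
  - rewrite (_ : ~` _ = (fun r => k s * k r) @^-1` [set x | x < 0]).
      by apply: open_comp => [r _|]; [exact: ck|exact: open_lt].
    apply/seteqP; split => r /=; last by move=> h /lt_gtF; rewrite h.
    by move/negP; rewrite -leNgt le_eqVlt mulf_eq0 !(negPf (k0 _)).
  - by exists s; rewrite /= -expr2 exprn_even_gt0//= k0.
have := pos (e s); rewrite /= /k wr (_ : det (- _) _ = - det (w s) (dg (e s))).
  by rewrite mulrN oppr_gt0.
by rewrite /det !pairE; ring.
Qed.

(** * Crossing and concurrence of nearby chords *)

Lemma chords_cross s0 : \forall d \near 0^'+, forall s1 s2,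
  ball s0 d s1 -> ball s0 d s2 -> s1 < s2 ->
  det (w s1) (w s2) != 0 /\ exists r1 r2,
    [/\ 0 <= r1 <= T s1, 0 <= r2 <= T s2 &
        g s1 + r1 *: w s1 = g s2 + r2 *: w s2].
Proof.
have ks := end_transverse_sign s0.
have k0 : det (w s0) (dg s0) != 0 by exact: w_transverse.
have k1 : det (w s0) (dg (e s0)) != 0.
  by apply: contraTneq ks => ->; rewrite mulr0 ltxx.
have [d1 d10 m1] := det_mono k0.
have [d2 d20 m2] := det_mono k1.
have : \forall s \near s0, [/\ ball s0 d1 s, ball (e s0) d2 (e s),
    ball (w s0) d1 (w s) & ball (w s0) d2 (w s)].
  have n1 : \forall s \near s0, ball s0 d1 s by exact: near_ball.
  have n2 : \forall s \near s0, ball (e s0) d2 (e s).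
    by apply: end_continuous; exact: nbhsx_ballx.
  have n3 : \forall s \near s0, ball (w s0) d1 (w s).
    by apply: w_continuous; exact: nbhsx_ballx.
  have n4 : \forall s \near s0, ball (w s0) d2 (w s).
    by apply: w_continuous; exact: nbhsx_ballx.
  by near=> s; split; near: s.
move=> /nbhs_ballP[d /= d0 dP]; near=> d' => s1 s2 b1 b2 lt12.
have dd : d' <= d by near: d'; exact: nbhs_right_le.
have [{}b1 e1 v1 v1'] := dP s1 (le_ball dd b1).
have [{}b2 e2 v2 v2'] := dP s2 (le_ball dd b2).
have elt := end_increasing lt12.
have [[T1 ge1 _] _] := eP s1; have [[T2 ge2 _] _] := eP s2.
(* Both parameter pairs are in increasing order, by [end_increasing], while the transversality signs
   at start and exit are opposite. Used with [v] equal to [w s1] and to [w s2], this gives the two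
   separation conditions. *)
have opp v : ball (w s0) d1 v -> ball (w s0) d2 v ->
    det v (g s2 - g s1) * det v (g (e s2) - g (e s1)) < 0.
  move=> bv bv'; have := m1 _ _ _ b1 b2 bv lt12.
  have := m2 _ _ _ e1 e2 bv' elt; move: ks.
  set a := det _ _; set b := det _ _; set x := det _ _; set y := det _ _.
  move=> ab bx ay; have : 0 < (b * x) * (a * y) by exact: mulr_gt0.
  rewrite (_ : _ * _ * _ = (a * b) * (y * x)); last by ring.
  by rewrite nmulr_rgt0.
by apply: crossing_segments => //; rewrite -ge1 -ge2; exact: opp.
Unshelve. all: by end_near.
Qed.

(** Heights are known relative to the start of the chord; the determinant of two points on one line
    is [r2 - r1] times [det (g s) (w s)], so the same law holds between any two points. *)
Lemma chord_lift s r1 r2 : 0 <= r1 <= T s -> 0 <= r2 <= T s ->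
  u (g s + r2 *: w s) - u (g s + r1 *: w s) =
  det (g s + r1 *: w s) (g s + r2 *: w s) / 2.
Proof.
have [[_ _ ins] _] := eP s; move=> /andP[a1 b1] /andP[a2 b2].
have ray r : 0 <= r <= T s -> u (g s + r *: w s) - u (g s) = r * det (g s) (w s) / 2.
  move=> /andP[a b]; apply: u_ray => // q /andP[qa qb].
  by apply: ins; rewrite qa (le_trans qb).
have h1 := ray r1; have h2 := ray r2; rewrite a1 b1 in h1; rewrite a2 b2 in h2.
transitivity (r2 * det (g s) (w s) / 2 - r1 * det (g s) (w s) / 2).
  by rewrite -h1// -h2//; ring.
by rewrite /det !pairE; field.
Qed.

(** Let [x] be the crossing of two fixed chords. Any later chord of the range crosses both, and the
    three crossings form a horizontal triangle; its degeneracy puts [x] on the later chord. The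
    conclusion says that [g s] lifts into the horizontal plane through the point over [x]. *)
Lemma concurrent_chords : exists a b x, a < b /\
  forall s, a <= s <= b -> u (g s) - u x = det x (g s) / 2.
Proof.
have [d d0 cross] : exists2 d : R, 0 < d & forall s1 s2 : R,
  ball 0 d s1 -> ball 0 d s2 -> s1 < s2 ->
  det (w s1) (w s2) != 0 /\ exists r1 r2,
    [/\ 0 <= r1 <= T s1, 0 <= r2 <= T s2 &
        g s1 + r1 *: w s1 = g s2 + r2 *: w s2].
  near (0 : R)^'+ => d; exists d; first by near: d; exact: nbhs_right_gt.
  by near: d; exact: chords_cross.
have b0 (s : R) : 0 <= s < d -> ball 0 d s.
  by move=> sd; rewrite /ball /= ltr_norml; lra.
have [|||k12 [r1 [r2 [r1T r2T e12]]]] := cross 0 (d / 4); try (by apply: b0; lra).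
  lra.
set x := g 0 + r1 *: w 0 in e12.
(* These parameters exceed those of the fixed chords, 0 and [d / 4], and remain below [d]. *)
exists (d / 2), (3 * d / 4), x; split => [|s sI]; first lra.
have [|||_ [q1 [q3 [q1T q3T e13]]]] := cross 0 s; try (by apply: b0; lra).
  lra.
have [|||_ [p2 [p3 [p2T p3T e23]]]] := cross (d / 4) s; try (by apply: b0; lra).
  lra.
set y := g 0 + q1 *: w 0 in e13; set z := g (d / 4) + p2 *: w (d / 4) in e23.
have [r xr] : exists2 r, 0 <= r <= T s & x = g s + r *: w s.
  have xy : y = x + (q1 - r1) *: w 0.
    by rewrite /x -addrA -scalerDl [r1 + _]addrC subrK.
  have xz : z = x + (p2 - r2) *: w (d / 4).
    by rewrite e12 -addrA -scalerDl [r2 + _]addrC subrK.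
  have h1 : u y - u x = det x y / 2 by exact: chord_lift.
  have h2 : u z - u x = det x z / 2 by rewrite e12; exact: chord_lift.
  have h3 : u z - u y = det y z / 2 by rewrite e13 e23; exact: chord_lift.
  (* [x] equals [y] or [z], and both of these are on the chord of [s]. *)
  have [->|->] := horizontal_triangle k12 xy xz h1 h2 h3.
    by exists q3.
  by exists p3.
move=> xe; have [[T0 _ _] _] := eP s.
have T0s : (0 : R) <= 0 <= T s by apply/andP; split; [exact: lexx|exact: ltW].
by have := chord_lift xr T0s; rewrite scale0r addr0 -xe.
Unshelve. all: by end_near.
Qed.

End EndMap.

Lemma curve_meets_horizontal_plane : exists a b x, a < b /\
  forall s, a <= s <= b -> u (g s) - u x = det x (g s) / 2.
Proof.
have /choice[f fP] : forall s, exists st,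
    chord s st.1 st.2 /\ s < st.1 < s + L.
  by move=> s; have [s' [t h]] := chord_exists s; exists (s', t).
exact: (concurrent_chords (e := fun s => (f s).1) (T := fun s => (f s).2)).
Qed.

End Chords.
End RegularDomain.
End SimpleClosed.
End PlaneCurve.

(** * Auxiliary derivatives *)

Lemma is_derive_linear {R : realType} {V W : normedModType R}
    (l : {linear V -> W}) (f : R -> V) (s : R) :
  continuous l -> differentiable f s ->
  is_derive s 1 (fun k => l (f k)) (l ('D_1 f s)).
Proof.
move=> cl df; have dl : differentiable l (f s) by exact: linear_differentiable.
have dlf : differentiable (l \o f) s by exact: differentiable_comp.
apply: DeriveDef; first exact: diff_derivable.
by rewrite (deriveE _ dlf) (deriveE _ df) diff_comp//= diff_lin.
Qed.

(** The derivative equals the limit of the left difference quotients, which vanish. This serves at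
    the end of a segment, where nothing is known beyond it. *)
Lemma derive_end_const {R : realType} (f : R -> R) (k t D : R) :
  is_derive t 1 f D -> 0 < t -> (forall r, 0 <= r <= t -> f r = k) -> D = 0.
Proof.
move=> fD t0 fk.
have /cvg_dnbhs_at_left c : h^-1 *: ((f \o shift t) (h *: 1) - f t) @[h --> 0^'] --> D.
  by have := @ex_derive _ _ _ _ _ _ _ fD; rewrite -[D]derive_val.
apply: (cvg_unique _ c) => //.
apply: cvg_near_cst; near=> h.
have h0 : h < 0 by near: h; exact: nbhs_left_lt.
have ht : - t < h by near: h; apply: nbhs_left_gt; lra.
rewrite /= /GRing.scale /= mulr1 !fk ?subrr ?mulr0//; lra.
Unshelve. all: by end_near.
Qed.

Lemma continuous_fst {U V : topologicalType} : continuous (@fst U V).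
Proof. by move=> x; exact: cvg_fst. Qed.

Lemma continuous_snd {U V : topologicalType} : continuous (@snd U V).
Proof. by move=> x; exact: cvg_snd. Qed.

(** * The contact form on a graph *)

Section GraphForm.
Context {R : realType}.
Variable u : R * R -> R.

Lemma derive_defect z v : differentiable u z.1 ->
  'D_v (fun P : heisenberg R => P.2 - u P.1) z = v.2 - 'D_v.1 u z.1.
Proof.
move=> du.
have d1 : differentiable (fst : heisenberg R -> R * R) z.
  by apply: linear_differentiable; exact: continuous_fst.
have d2 : differentiable (snd : heisenberg R -> R) z.
  by apply: linear_differentiable; exact: continuous_snd.
have du1 : differentiable (u \o fst : heisenberg R -> R) z by exact: differentiable_comp.
have dd : differentiable ((snd : heisenberg R -> R) - (u \o fst)) z by exact: differentiableB.
transitivity ('D_v ((snd : heisenberg R -> R) - (u \o fst)) z) => //.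
rewrite (deriveE _ dd) diffB//= diff_comp//= (deriveE _ du) !diff_lin//.
all: by [exact: continuous_fst|exact: continuous_snd].
Qed.

Lemma gpE z : differentiable u z -> gp u z = - (z.2 / 2) - 'D_(1, 0) u z.
Proof. by move=> du; rewrite /gp derive_defect. Qed.

Lemma gqE z : differentiable u z -> gq u z = z.1 / 2 - 'D_(0, 1) u z.
Proof. by move=> du; rewrite /gq derive_defect. Qed.

Lemma derive_plane z v : differentiable u z ->
  'D_v u z = v.1 * 'D_(1, 0) u z + v.2 * 'D_(0, 1) u z.
Proof.
move=> du; rewrite !(deriveE _ du).
have {1}-> : v = v.1 *: (1, 0) + v.2 *: (0, 1).
  by apply: eq_pair; rewrite !pairE /=; ring.
by rewrite linearD !linearZ.
Qed.

(* [gp dx + gq dy] is, up to sign, the pullback to the graph of the contact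
   form [dt - (x dy - y dx) / 2]. *)
Lemma contact_form z v : differentiable u z ->
  gp u z * v.1 + gq u z * v.2 = det z v / 2 - 'D_v u z.
Proof.
by move=> du; rewrite gpE// gqE// (derive_plane v du) /det; field.
Qed.

Lemma is_derive_line z v (k : R) : differentiable u (z + k *: v) ->
  is_derive k 1 (fun k : R => u (z + k *: v)) ('D_v u (z + k *: v)).
Proof.
move=> du; have : derivable u (z + k *: v) v by exact: diff_derivable.
rewrite /derivable /derive.
have e : (fun h : R => h^-1 *: ((u \o shift (z + k *: v)) (h *: v) - u (z + k *: v)))
    = (fun h : R => h^-1 *: (((fun k => u (z + k *: v)) \o shift k) (h *: 1)
        - u (z + k *: v))).
  apply/funext => h /=; congr (_ *: (u _ - _)).
  by rewrite addrCA -scalerDl -[h in LHS]mulr1.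
by move=> c; apply: DeriveDef; rewrite /derivable /derive -e.
Qed.

End GraphForm.

Lemma derive_affine {R : realType} {V : normedModType R} (p v : V) (s : R) :
  'D_1 (fun k : R => p + k *: v) s = v.
Proof.
rewrite /derive; apply: lim_near_cst; first exact: norm_hausdorff.
near=> h; have h0 : h != 0 by near: h; exact: nbhs_dnbhs_neq.
rewrite /= scalerDl opprD addrACA subrr add0r addrK scalerA.
by rewrite [h%:A]mulr1 mulVf// scale1r.
Unshelve. all: by end_near.
Qed.

(** The image of the interval from 0 to [t] is connected and contains 0. The factor [b] allows
    either orientation, since the inward direction may oppose that of the rule. *)
Lemma component_ray {R : realType} (D : set (R * R)) z v (b t : R) : 0 <= t ->
  (forall q, 0 <= q <= t -> D (z + (q * b) *: v)) ->
  connected_component [set s : R | D (z + s *: v)] 0 (t * b).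
Proof.
move=> t0 h; apply: (connected_component_max (B := ( *%R^~ b) @` [set` `[0, t]])).
- by exists 0; rewrite ?mul0r//= in_itv /= lexx.
- by move=> _ [q /= qI <-]; apply: h; rewrite in_itv /= in qI.
- apply: connected_continuous_connected; first exact: segment_connected.
  by apply: continuous_subspaceT => x; exact: mulrr_continuous.
- by exists t => //=; rewrite in_itv /= t0 lexx.
Qed.

(** * Rules *)

Section RuledGraph.
Context {R : realType}.
Variables (W U : set (R * R)) (u : R * R -> R).
Hypothesis W_closed : closed W.
Hypothesis U_open : open U.
Hypothesis WU : W `<=` U.
Hypothesis u_C1 : C1_on U u.

Lemma graph_differentiable z : W z -> differentiable u z.
Proof. by move=> /WU/u_C1[]. Qed.

Lemma gp_continuous z : W z -> {for z, continuous (gp u)}.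
Proof.
move=> Wz; have Uz := WU Wz; have [du cD] := u_C1 Uz.
have e : \forall y \near z, - (y.2 / 2) - 'D_(1, 0) u y = gp u y.
  have : nbhs z U by exact: open_nbhs_nbhs.
  by apply: filterS => y /u_C1[dy _]; rewrite gpE.
suff c : gp u y @[y --> z] --> gp u z by [].
rewrite (gpE du); apply: cvg_trans (near_eq_cvg e) _.
apply: cvgB; last exact: cD.
by apply: cvgN; apply: cvgM; [exact: cvg_snd|exact: cvg_cst].
Qed.

Lemma gq_continuous z : W z -> {for z, continuous (gq u)}.
Proof.
move=> Wz; have Uz := WU Wz; have [du cD] := u_C1 Uz.
have e : \forall y \near z, y.1 / 2 - 'D_(0, 1) u y = gq u y.
  have : nbhs z U by exact: open_nbhs_nbhs.
  by apply: filterS => y /u_C1[dy _]; rewrite gqE.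
suff c : gq u y @[y --> z] --> gq u z by [].
rewrite (gqE du); apply: cvg_trans (near_eq_cvg e) _.
apply: cvgB; last exact: cD.
by apply: cvgM; [exact: cvg_fst|exact: cvg_cst].
Qed.

Lemma char_locus_closed : closed (char_locus W u).
Proof.
rewrite -[char_locus W u]setCK; apply: open_closedC; rewrite openE.
suff main (z : R * R) : ~ char_locus W u z -> nbhs z (~` char_locus W u) by exact: main.
move=> nz.
have [Wz|nW] := pselect (W z); last first.
  have : nbhs z (~` W) by apply: open_nbhs_nbhs; split => //; exact: closed_openC.
  by apply: filterS => y nWy [].
have [p0|p0] := eqVneq (gp u z) 0; last first.
  near=> y => -[_ [p0' _]]; have : gp u y != 0.
    by near: y; exact: cvgr_neq0 (gp_continuous Wz) p0.
  by rewrite p0' eqxx.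
have q0 : gq u z != 0.
  apply/eqP => q0; exact: nz (conj Wz (conj p0 q0)).
near=> y => -[_ [_ q0']]; have : gq u y != 0.
  by near: y; exact: cvgr_neq0 (gq_continuous Wz) q0.
by rewrite q0' eqxx.
Unshelve. all: by end_near.
Qed.

(** The Gauss map turned by a right angle; it is 0 at characteristic points of [W]. *)
Definition rule_direction z : R * R := (gqbar u z, - gpbar u z).

Lemma gauss_norm_gt0 z : nonchar W u z ->
  0 < Num.sqrt (gp u z ^+ 2 + gq u z ^+ 2).
Proof.
move=> [Wz]; apply: contra_notP => /negP; rewrite sqrtr_gt0 -leNgt => n0.
have p0 : gp u z ^+ 2 = 0 by have := sqr_ge0 (gp u z); have := sqr_ge0 (gq u z); lra.
have q0 : gq u z ^+ 2 = 0 by have := sqr_ge0 (gp u z); have := sqr_ge0 (gq u z); lra.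
have {}p0 : gp u z = 0 by apply/eqP; rewrite -sqrf_eq0; apply/eqP; exact: p0.
have {}q0 : gq u z = 0 by apply/eqP; rewrite -sqrf_eq0; apply/eqP; exact: q0.
exact: (conj Wz (conj p0 q0)).
Qed.

Lemma rule_direction_unit z : nonchar W u z ->
  dot (rule_direction z) (rule_direction z) = 1.
Proof.
move=> /gauss_norm_gt0; rewrite /dot /rule_direction /gqbar /gpbar /=.
set n := Num.sqrt _ => n0.
have nn : n * n = gp u z ^+ 2 + gq u z ^+ 2.
  by rewrite -expr2 sqr_sqrtr// addr_ge0 ?sqr_ge0.
transitivity ((gp u z ^+ 2 + gq u z ^+ 2) / (n * n)).
  by field; rewrite gt_eqF.
by rewrite -nn divff// mulf_neq0 ?gt_eqF.
Qed.

Lemma rule_direction_continuous z : nonchar W u z ->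
  {for z, continuous rule_direction}.
Proof.
move=> nz; have n0 := gauss_norm_gt0 nz; have [Wz _] := nz.
have cp := gp_continuous Wz; have cq := gq_continuous Wz.
have sq (f : R * R -> R) : f y @[y --> z] --> f z ->
    f y ^+ 2 @[y --> z] --> f z ^+ 2.
  by move=> cf; exact: (cvgM cf cf).
have cn : (Num.sqrt (gp u y ^+ 2 + gq u y ^+ 2))^-1 @[y --> z] -->
    (Num.sqrt (gp u z ^+ 2 + gq u z ^+ 2))^-1.
  apply: cvgV; first by rewrite gt_eqF.
  apply: (cvg_comp _ Num.sqrt); last exact: sqrt_continuous.
  by apply: cvgD; [exact: sq cp|exact: sq cq].
apply: (@cvg_pair _ _ _ _ (nbhs (gqbar u z)) (nbhs (- gpbar u z))).
  exact: (cvgM cq cn).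
by apply: cvgN; exact: (cvgM cp cn).
Qed.

(** The determinant is the contact form divided by a positive norm. Hence a plane curve is
    transverse to the rule exactly where its lift to the graph is not Legendrian. *)
Lemma rule_direction_det z v : nonchar W u z ->
  det (rule_direction z) v != 0 <-> gp u z * v.1 + gq u z * v.2 != 0.
Proof.
move=> nz; have n0 := gauss_norm_gt0 nz.
rewrite (_ : det _ v = (Num.sqrt (gp u z ^+ 2 + gq u z ^+ 2))^-1 *
    (gp u z * v.1 + gq u z * v.2)); last first.
  by rewrite /det /rule_direction /gqbar /gpbar /=; ring.
by rewrite mulf_eq0 invr_eq0 gt_eqF.
Qed.

Hypothesis ruled : ruled_off_char W u.
Hypothesis extend : rules_extend W u.

(** The height law is that of a horizontal line; the point is that the line is still on the graph.
    If the closure of the rule meets the characteristic locus, the extension property gives this;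
    otherwise the segment contains no characteristic point at all. *)
Lemma rule_lifts z (b t : R) : nonchar W u z -> 0 <= t ->
  (forall q, 0 <= q <= t -> W (z + (q * b) *: rule_direction z)) ->
  u (z + (t * b) *: rule_direction z) - u z =
  t * b * det z (rule_direction z) / 2.
Proof.
move=> nz t0 ins; have [r [ruler r0]] := ruled nz.
have [[p [v rE]] hor _ str] := ruler.
have pE : p = graph_pt u z by rewrite -r0 rE scale0r addr0.
have r1E k : (r k).1 = z + k *: v.1 by rewrite rE pE.
have dE : derive1 r 0 = v.
  by rewrite derive1E (_ : r = fun k => p + k *: v) ?derive_affine//; exact/funext.
have v1E : v.1 = rule_direction z.
  have [] := str 0; first by apply: connected_component_refl; rewrite /= r0.
  move=> _ []; rewrite r0 => _ dv.
  transitivity ('D_1 (fun k => (r k).1) 0); last exact: dv.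
  rewrite (_ : (fun k => (r k).1) = fun k => z + k *: v.1) ?derive_affine//.
  exact/funext.
(* Horizontality at the base point determines the vertical slope of the line. *)
have v2E : v.2 = det z v.1 / 2.
  have := hor 0; rewrite dE r0 => -[al [be]] ve.
  have -> : v.1 = (al, be) by rewrite ve; apply: eq_pair; rewrite /= /GRing.scale /=; ring.
  by rewrite ve /det /= /GRing.scale /=; field.
have onS k : graph_over W u (r k) ->
    u (z + k *: v.1) - u z = k * det z v.1 / 2.
  move=> [y Wy]; rewrite rE pE /graph_pt => -[yE uE].
  have -> : z + k *: v.1 = y by rewrite yE.
  by rewrite uE v2E /GRing.scale /=; ring.
have strE D : stretch D r = connected_component [set s | D (z + s *: v.1)] 0.
  by rewrite /stretch; congr connected_component; apply/seteqP; split => s /=; rewrite r1E.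
rewrite -v1E in ins *; apply: onS.
have [ch|nch] := pselect (exists2 s, closure (stretch (nonchar W u) r) s &
    char_locus W u (r s).1).
  by apply: (extend ruler ch); rewrite strE; exact: component_ray t0 ins.
suff nonc q : 0 <= q <= t -> nonchar W u (z + (q * b) *: v.1).
  by have [] := str (t * b); first by rewrite strE; exact: component_ray t0 nonc.
move=> qI; split; first exact: ins; move=> chq; apply: nch.
pose f (q : R) := z + (q * b) *: v.1.
have cf : continuous f.
  move=> y; apply: cvgD; first exact: cvg_cst.
  by apply: cvgZ; [exact: mulrr_continuous|exact: cvg_cst].
pose K := [set` `[0, q]] `&` f @^-1` (char_locus W u).
have cK : compact K.
  apply: compact_closedI; first exact: segment_compact.
  apply: preimage_closed; first by move=> x _; exact: cf.
  exact: char_locus_closed.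
(* [q0] is the first characteristic time. Everything before it belongs to the rule, so it lies in
   the closure of the rule, contrary to [nch]. *)
have [q0 q0K qmin] : exists2 t, t \in K & forall r, r \in K -> t <= r.
  apply: (@compact_EVT_min _ _ id) => //.
    by exists q; split => //; rewrite /= in_itv /=; lra.
  by apply: continuous_subspaceT => y; exact: cvg_id.
move: q0K => /set_mem[]; rewrite /= in_itv /= => /andP[q00 q0q] chq0.
have early y : 0 <= y < q0 -> stretch (nonchar W u) r (y * b).
  move=> /andP[y0 yq]; rewrite strE; apply: component_ray => // x /andP[x0 xy].
  split; first by apply: ins; lra.
  move=> chx; have : x \in K by apply/mem_set; split => //; rewrite /= in_itv /=; lra.
  by move/qmin; lra.
have q0pos : 0 < q0.
  rewrite lt_neqAle q00 andbT; apply/eqP => q0E; case: nz => _; apply.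
  by move: chq0; rewrite /f -q0E mul0r scale0r addr0.
exists (q0 * b); last by rewrite r1E.
move=> N Nq; have : \forall y \near q0^'-, N (y * b).
  have : \forall y \near q0, N (y * b) by exact: mulrr_continuous Nq.
  exact: cvg_at_left_filter.
move=> nN; near q0^'- => y; exists (y * b); split; last by near: y.
apply: early; apply/andP; split; last by near: y; exact: nbhs_left_lt.
by near: y; exact: nbhs_left_ge.
Unshelve. all: by end_near.
Qed.

(** By [rule_lifts], [u] is affine along the segment, with slope half the determinant; this is also
    half of [det y (b *: v)], so the contact form vanishes on [v] at the far end. *)
Lemma rule_tangent z (b t : R) : nonchar W u z -> b != 0 -> 0 < t ->
  (forall q, 0 <= q <= t -> W (z + (q * b) *: rule_direction z)) ->
  let y := z + (t * b) *: rule_direction z in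
  gp u y * (rule_direction z).1 + gq u y * (rule_direction z).2 = 0.
Proof.
move=> nz b0 t0 ins y; set v := rule_direction z.
have dy : differentiable u y.
  by apply: graph_differentiable; apply: ins; rewrite lexx ltW.
have yE : y = z + t *: (b *: v) by rewrite scalerA.
have lift q : 0 <= q <= t ->
    u (z + q *: (b *: v)) - (b * det z v / 2) *: q = u z.
  move=> /andP[q0 qt]; have h : u (z + (q * b) *: v) - u z = q * b * det z v / 2.
    apply: (rule_lifts nz q0) => r /andP[r0 rq]; apply: ins.
    by rewrite r0 (le_trans rq).
  have e : (b * det z v / 2) *: q = q * b * det z v / 2.
    by rewrite /GRing.scale /=; ring.
  by rewrite scalerA e -h opprB addrC subrK.
have dl : is_derive t 1 (fun q => u (z + q *: (b *: v)) - (b * det z v / 2) *: q)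
    ('D_(b *: v) u y - b * det z v / 2).
  rewrite yE in dy *; have h := is_derive_line dy.
  have := is_deriveB h (is_deriveZ (b * det z v / 2) (is_derive_id t (1 : R))).
  by rewrite [_%:A]mulr1.
have /subr0_eq d0 := derive_end_const dl t0 lift.
have := contact_form (b *: v) dy; rewrite d0 !pairE.
have -> : det y (b *: v) = b * det z v.
  by rewrite /y /det !pairE; ring.
rewrite subrr => h; apply: (mulfI b0); rewrite mulr0 -h; ring.
Qed.

End RuledGraph.

(** * From the spanning surface to the plane curve *)

(** Shift the smaller parameter into the first period. If the other falls into the second,
    subtracting [L] and using injectivity would make the distance exactly [L]. *)
Lemma simple_period_inj {R : realType} {T : Type} (f : R -> T) (L : R) :
  0 < L -> (forall s, f (s + L) = f s) ->
  (forall s s', 0 <= s < L -> 0 <= s' < L -> f s = f s' -> s = s') ->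
  forall s s', f s = f s' -> `|s - s'| < L -> s = s'.
Proof.
move=> L0 fL finj; suff main s s' : f s = f s' -> s <= s' -> s' - s < L -> s = s'.
  move=> s s' ff; rewrite ltr_norml => /andP[h1 h2]; have [le|/ltW le] := leP s s'.
    by apply: main => //; lra.
  by apply/esym; apply: main => //; lra.
move=> ff le lt; have [n /andP[h1 h2]] := period_representative 0 s L0.
have fs : f (s + n%:~R * L) = f (s' + n%:~R * L) by rewrite !periodicz.
have [lt'|ge'] := ltP (s' + n%:~R * L) L.
  have : s + n%:~R * L = s' + n%:~R * L.
    by apply: finj => //; apply/andP; split; lra.
  by move/addIr.
have : s + n%:~R * L = s' + n%:~R * L - L.
  apply: finj; [by apply/andP; split; lra|by apply/andP; split; lra|].
  by rewrite fs -[RHS]fL subrK.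
lra.
Qed.

Unset Implicit Arguments.

Theorem theorem5 (R : realType) (L : R) (c : R -> heisenberg R)
  (hc : closed_C1_curve L c)
  (hgraph : graph_over_projection c)
  (hleg : forall s, ~ legendrian_point c s)
  (hspan : exists (W : set (R * R)) (u : R * R -> R),
     C1_ruled_H_minimal_graph W u /\ spans W u c) :
  exists a b : R, a < b /\
    exists2 A : set (heisenberg R), is_plane A & c @` `[a, b] `<=` A.
Proof.
have [L0 cC1 cL cinj] := hc.
have [W [u [[[Wc [D [Do _ _ WD]]] [U [Uo WU uC1]] _ ruled extend] [bW gW]]]] := hspan.
have Wcl : closed W by apply: compact_closed => //; exact: norm_hausdorff.
pose g := proj_curve c; pose dg s := ('D_1 c s).1.
have dc s : differentiable c s by have [] := cC1 s I.
have dgd s : differentiable g s.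
  apply: differentiable_comp; first exact: dc.
  by apply: linear_differentiable; exact: continuous_fst.
have dgE s : 'D_1 g s = dg s.
  by have := is_derive_linear (@continuous_fst _ _) (dc s) => /@derive_val.
have g1 (s : R) : is_derive s 1 (fun k => (g k).1) (dg s).1.
  by rewrite -dgE; exact: is_derive_linear (@continuous_fst _ _) (dgd s).
have g2 (s : R) : is_derive s 1 (fun k => (g k).2) (dg s).2.
  by rewrite -dgE; exact: is_derive_linear (@continuous_snd _ _) (dgd s).
have dgc : continuous dg.
  move=> s; have [_ /(_ 1) c1] := cC1 s I.
  exact: (cvg_comp _ _ c1 (@continuous_fst _ _ _)).
have gL s : g (s + L) = g s by rewrite /g /proj_curve cL.
have ginj s s' : g s = g s' -> `|s - s'| < L -> s = s'.
  by move=> /hgraph; exact: simple_period_inj.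
have Wb : W `\` W° = range g.
  by rewrite -bW /boundary -(closure_id W).1.
(* [D] is open and contained in [W], hence in its interior. *)
have Wreg : W `<=` closure W°.
  rewrite {1}WD; apply: closure_subset; rewrite -open_subsetE// WD.
  exact: subset_closure.
have Wg s : W (g s) by exact: (curve_in Wb).
have cu s : (c s).2 = u (g s).
  have : graph_over (boundary W) u (c s) by rewrite gW; exists s.
  by move=> [z _ zc]; rewrite /g /proj_curve -zc.
have ud s : differentiable u (g s) by exact: graph_differentiable uC1 _ (Wg s).
have dcu s : ('D_1 c s).2 = 'D_(dg s) u (g s).
  have := is_derive_linear (@continuous_snd _ _) (dc s) => /@derive_val <-.
  rewrite (_ : (fun k => (c k).2) = u \o g); last exact/funext.
  have dug : differentiable (u \o g) s by exact: differentiable_comp.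
  by rewrite (deriveE _ dug) diff_comp//= -(deriveE _ (dgd s)) dgE (deriveE _ (ud s)).
(* If the form vanished on [dg s], then [c'] would be the combination of [X1] and [X2] with the
   components of [dg s] as coefficients, and the point would be Legendrian. *)
have contact s : gp u (g s) * (dg s).1 + gq u (g s) * (dg s).2 != 0.
  apply/eqP => h; apply: (hleg s); exists (dg s).1, (dg s).2.
  rewrite derive1E; apply: eq_pair.
    by apply: eq_pair; rewrite /= /GRing.scale /=; ring.
  move: h; rewrite (contact_form _ (ud s)) -dcu => /subr0_eq <-.
  rewrite /det /g /proj_curve.
  transitivity ((dg s).1 * - ((c s).1.2 / 2) + (dg s).2 * ((c s).1.1 / 2)) => //.
  by field.
(* At a characteristic point both coefficients of the form vanish, against [contact]. *)
have nonc s : nonchar W u (g s).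
  split; first exact: Wg.
  move=> [_ [p0 q0]]; have := contact s.
  by rewrite p0 q0 !mul0r addr0 eqxx.
pose V s := rule_direction u (g s).
have Vc : continuous V.
  move=> s; apply: (cvg_comp g (rule_direction u)).
    exact: curve_continuous g1 g2 s.
  exact: rule_direction_continuous Uo WU uC1 _ (nonc s).
have Vu s : dot (V s) (V s) = 1 by exact: rule_direction_unit (nonc s).
have Vt s : det (V s) (dg s) != 0 by apply/(rule_direction_det _ (nonc s)).2.
have [b b1 win] := inward_sign g1 g2 dgc L0 gL ginj Wc Wreg Wb Vc Vu Vt.
have b0 : b != 0 by case: b1 => ->; rewrite ?oppr_eq0 oner_eq0.
have bb : b * b = 1 by case: b1 => ->; rewrite ?mulrNN mulr1.
pose w s := b *: V s.
have wc : continuous w.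
  by move=> s; apply: cvgZ; [exact: cvg_cst|exact: Vc].
have wu s : dot (w s) (w s) = 1.
  by rewrite dotZ bb mul1r Vu.
have wt s : det (w s) (dg s) != 0.
  by rewrite detZl mulf_neq0.
have wp s s' : g s = g s' -> w s = w s' by rewrite /w /V => ->.
have inside s t : ray_inside g W w s t -> forall q : R, 0 <= q <= t ->
    W (g s + (q * b) *: rule_direction u (g s)).
  by move=> h q /h; rewrite /w scalerA.
have uray s t : 0 <= t -> ray_inside g W w s t ->
    u (g s + t *: w s) - u (g s) = t * det (g s) (w s) / 2.
  move=> t0 /inside h.
  have := rule_lifts Wcl Uo WU uC1 ruled extend (nonc s) t0 h.
  rewrite /w scalerA => ->.
  by rewrite detZr mulrA.
have wray s s' t : 0 < t -> ray_inside g W w s t -> g s' = g s + t *: w s ->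
    w s' = w s \/ w s' = - w s.
  move=> t0 /inside h gs'.
  have := rule_tangent Wcl Uo WU uC1 ruled extend (nonc s) b0 t0 h.
  (* The incoming direction annihilates the form at [g s'], so it is parallel to the rule there;
     unit vectors then agree up to sign. *)
  rewrite /= -scalerA -/(V s) -/(w s) -gs' => tan.
  apply: parallel_unit => //; apply/eqP; apply: contraT => dn.
  have : det (V s') (V s) != 0.
    by apply: contraNneq dn => d0; rewrite detZl detZr d0 !mulr0.
  by move/(rule_direction_det _ (nonc s')).1; rewrite tan eqxx.
have [s1 [s2 [x [lt12 hp]]]] := curve_meets_horizontal_plane
  g1 g2 dgc L0 gL ginj Wc Wb wc wu wt wp win uray wray.
exists s1, s2; split => //.
(* This is the horizontal plane at the point of height [u x] over [x]. *)
exists [set P | x.2 / 2 * P.1.1 + - x.1 / 2 * P.1.2 + 1 * P.2 = u x].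
  exists (x.2 / 2), (- x.1 / 2), 1, (u x); split => //.
  by move=> [_ _ /eqP]; rewrite oner_eq0.
move=> _ [s sI <-] /=; have := hp s; rewrite /= in_itv /= in sI.
by rewrite -cu /det => /(_ sI) h; rewrite /g /proj_curve in h; lra.
Qed.
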